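(* Let $U_0,\ldots,U_{n-1}$ be $m\times m$ real matrices such that the $n\times n$ block-triangular block-Toeplitz matrix $\mathcal{T}(U)$ is a subgenerator. Let $K\ge n$, let $U^{(K)}=(U_i^{(K)})_{i=0,\ldots,K-1}$ with $U_i^{(K)}=U_i$ for $0\le i\le n-1$ and $U_i^{(K)}=0$ for $n\le i\le K-1$, and let $A^{(K)}=(A_i)_{i=0,\ldots,K-1}$ be the block-vector such that $\mathcal{T}(A^{(K)})=e^{\mathcal{T}(U^{(K)})}$. Then, for every $\sigma>1$, $$A_i\mathbf{1}\le e^{\alpha(\sigma^{n-1}-1)}\,\sigma^{-i}\,\mathbf{1},\qquad i=0,\ldots,K-1,$$ where $\alpha=\max_j(-(U_0)_{j,j})$ and the inequality is componentwise.
   Context: For a block-vector $B=(B_i)_{i=0,\ldots,N-1}$ of $m\times m$ matrices, $\mathcal{T}(B)$ is the $N\times N$ block upper triangular block-Toeplitz matrix whose $(i,j)$ block is $B_{j-i}$ if $j\ge i$ and $0$ if $j<i$. Such matrices form an algebra, so the exponential of $\mathcal{T}(B)$ is again of this form. A subgenerator is a real square matrix whose off-diagonal entries are nonnegative, whose diagonal entries are negative, and whose row sums are all nonpositive. $\mathbf{1}$ is the column vector with all entries equal to $1$. *)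

(* Defs.v *)
From HB Require Import structures.
From mathcomp Require Export all_boot all_order all_algebra.
From mathcomp Require Export classical_sets reals topology normedtype sequences.
From mathcomp Require Export exp.

Set Implicit Arguments.
Unset Strict Implicit.
Unset Printing Implicit Defensive.

Import Order.TTheory GRing.Theory Num.Theory.
Import numFieldNormedType.Exports.

Local Open Scope classical_set_scope.
Local Open Scope ring_scope.

Definition subgenerator (R : realType) (d : nat) (M : 'M[R]_d) : Prop :=
  [/\ forall i j, i != j -> 0 <= M i j,
      forall i, M i i < 0
    & forall i, \sum_j M i j <= 0].

(* Convergence is entrywise: it refers to the product topology on matrices. *)
Definition expmx (R : realType) (d : nat) (M : 'M[R]_d) : 'M[R]_d :=
  limn (series (fun k : nat => (k`!%:R)^-1 *: M ^+ k)).

Definition ord_subn (N : nat) (j : 'I_N) (i : nat) : 'I_N :=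
  Ordinal (leq_ltn_trans (leq_subr i j) (ltn_ord j)).

Definition toeplitz (R : realType) (m N : nat) (B : 'I_N -> 'M[R]_m) :
    'M[R]_(\sum_(i < N) m) :=
  \mxblock_(i < N, j < N) (if (i <= j)%N then B (ord_subn j i) else 0).

Definition zero_pad (R : realType) (m n K : nat) (U : 'I_n -> 'M[R]_m) :
    'I_K -> 'M[R]_m :=
  fun i => if insub (val i) is Some i' then U i' else 0.
Arguments zero_pad {R m n} K U.

Definition ones (R : realType) (m : nat) : 'cV[R]_m := const_mx 1.
Arguments ones {R m}.

(* The maximum of the opposites of the diagonal entries of M, for a matrix whose
   diagonal is negative: the neutral value 0 then matters only if m = 0. *)
Definition max_opp_diag (R : realType) (m : nat) (M : 'M[R]_m) : R :=
  \big[Num.max/0]_(j < m) - M j j.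

(* Main.v *)
(* Let T be the Toeplitz matrix of the padded blocks and x the block vector with
   blocks sigma^k 1.  Row sums of T(U) are nonpositive, so the blocks U_i with
   i >= 1 contribute at most alpha to each row sum of T, and sigma^i exceeds 1
   by at most sigma^(n-1) - 1 on them: T x <= beta x with
   beta = alpha (sigma^(n-1) - 1).  As T is nonnegative off the diagonal,
   I + T/N is nonnegative for large N, hence (I + T/N)^N x <= e^beta x, and
   N -> oo gives e^T x <= e^beta x.  The first block row of e^T x is
   \sum_i sigma^i A_i 1, a sum of nonnegative terms. *)
Require Import Defs.
From mathcomp Require Import matrix_normedtype.
From mathcomp Require Import boolp lra ring.
Set Implicit Arguments.
Unset Strict Implicit.
Unset Printing Implicit Defensive.

Import Order.TTheory GRing.Theory Num.Theory.
Import numFieldNormedType.Exports.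
Local Open Scope classical_set_scope.
Local Open Scope ring_scope.

(** * Scalar compound-interest limits *)

Lemma bin_fact_le_expn (n k : nat) : ('C(n, k) * k`! <= n ^ k)%N.
Proof.
rewrite bin_ffact; elim: k => [|k IHk]; first by rewrite ffactn0.
by rewrite ffactnSr expnSr leq_mul ?leq_subr.
Qed.

(** With [y = x / N], the power is squeezed between [expR (x / (1 + y))] and [expR x]. Both bounds
    are [N]-th powers of instances of [1 + t <= expR t]: [t = y] gives the upper one, and
    [t = - y / (1 + y)], after inversion, the lower one. *)
Lemma cvg_expR_compound (R : realType) (x : R) : 0 <= x ->
  (1 + x / n.+1%:R) ^+ n.+1 @[n --> \oo] --> expR x.
Proof.
move=> x_ge0.
have cvg_arg : x / (1 + x / n.+1%:R) @[n --> \oo] --> x / (1 + x * 0).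
  apply: cvgM; first exact: cvg_cst.
  apply: cvgV; first by rewrite mulr0 addr0 oner_neq0.
  apply: cvgD; first exact: cvg_cst.
  by apply: cvgM; [exact: cvg_cst | exact: cvg_harmonic].
rewrite mulr0 addr0 divr1 in cvg_arg.
have cvg_lower : expR (x / (1 + x / n.+1%:R)) @[n --> \oo] --> expR x.
  by apply: continuous_cvg cvg_arg; exact: continuous_expR.
apply: (squeeze_cvgr _ cvg_lower (cvg_cst (expR x))).
near=> n.
have Sn_gt0 : 0 < n.+1%:R :> R by rewrite ltr0Sn.
have y_ge0 : 0 <= x / n.+1%:R by rewrite divr_ge0.
move: (y_ge0); set y := x / _ => {}y_ge0.
have xE : x = y * n.+1%:R by rewrite mulfVK ?gt_eqF.
have y1_gt0 : 0 < 1 + y by lra.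
apply/andP; split; last first.
  by rewrite xE expRM_natr lerXn2r ?nnegrE ?expR_ge0 ?expR_ge1Dx ?ltW.
rewrite xE mulrAC expRM_natr lerXn2r ?nnegrE ?expR_ge0 ?(ltW y1_gt0)//.
rewrite -[leRHS]invrK -[leLHS]invrK lef_pV2 ?posrE ?invr_gt0 ?expR_gt0//.
rewrite -expRN; apply: le_trans (expR_ge1Dx _).
rewrite le_eqVlt; apply/orP; left; apply/eqP.
by field; rewrite gt_eqF.
Unshelve. all: by end_near. Qed.

Lemma near_compound_ge0 (R : realType) (x : R) :
  \forall n \near \oo, 0 <= 1 + x / n.+1%:R.
Proof.
have : 1 + x / n.+1%:R @[n --> \oo] --> 1 + x * 0.
  apply: cvgD; first exact: cvg_cst.
  by apply: cvgM; [exact: cvg_cst | exact: cvg_harmonic].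
by rewrite mulr0 addr0 => /cvgr_ge; apply; rewrite ltr01.
Qed.

Lemma cvg_mx_coord (R : realType) (m n : nat) (f : nat -> 'M[R]_(m, n))
    (L : 'M[R]_(m, n)) :
  (forall i j, f k i j @[k --> \oo] --> L i j) -> f k @[k --> \oo] --> L.
Proof.
move=> fL; apply/cvg_mx_entourageP => A entA.
apply: filter_forall => i; apply: filter_forall => j.
have /cvg_app_entourageP/(_ A entA) := fL i j.
by apply: filterS => k /mem_set.
Qed.

(** * Convergence of the exponential series and of the compound powers *)

Section matrix_exponential.
Variables (R : realType) (d : nat) (M : 'M[R]_d).

(** This norm dominates every absolute row sum of [M], so the entries of [M ^+ k] are at most
    [c ^+ k] in absolute value, and the scalar exponential series at [c] dominates the matrix series
    entry by entry. *)
Let c : R := \sum_i \sum_j `|M i j|.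

Let c_ge0 : 0 <= c.
Proof. by apply: sumr_ge0 => i _; apply: sumr_ge0. Qed.

Let norm_exprmx k i j : `|(M ^+ k) i j| <= c ^+ k.
Proof.
elim: k i j => [|k IHk] i j.
  by rewrite !expr0 mxE; case: (i == j); rewrite ?normr1 ?normr0 ?ler01.
rewrite exprS -mulmxE mxE (le_trans (ler_norm_sum _ _ _))// exprS.
apply: (@le_trans _ _ (\sum_l `|M i l| * c ^+ k)).
  by apply: ler_sum => l _; rewrite normrM ler_wpM2l.
rewrite -mulr_suml ler_wpM2r ?exprn_ge0//.
by rewrite /c [leRHS](bigD1 i)//= lerDl sumr_ge0// => l _; rewrite sumr_ge0.
Qed.

Let norm_coef k i j : `|(k`!%:R^-1 *: M ^+ k) i j| <= exp_coeff c k.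
Proof.
rewrite mxE normrM ger0_norm ?invr_ge0// /exp_coeff/= mulrC.
by rewrite ler_wpM2r ?invr_ge0.
Qed.

Lemma expmx_coord i j :
  series (fun k => (k`!%:R^-1 *: M ^+ k) i j) n @[n --> \oo]
    --> expmx M i j.
Proof.
pose u i j := fun k => (k`!%:R^-1 *: M ^+ k) i j.
have cvg_u i' j' : cvgn (series (u i' j')).
  apply: normed_cvg; apply: (series_le_cvg (v_ := exp_coeff c)).
  - by move=> k; rewrite normr_ge0.
  - by move=> k; rewrite exp_coeff_ge0.
  - by move=> k; exact: norm_coef.
  - exact: is_cvg_series_exp_coeff.
have seriesE i' j' : series (u i' j') =
    (fun n => series (fun k => k`!%:R^-1 *: M ^+ k) n i' j').
  by apply/funext => n; rewrite /series/= summxE.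
(* [expmx] is a [limn], which is informative only once the series is known to converge; the matrix
   of the entrywise limits witnesses this. *)
have /cvgP cvg_expmx : series (fun k => k`!%:R^-1 *: M ^+ k) n @[n --> \oo]
    --> \matrix_(i', j') limn (series (u i' j')).
  by apply: cvg_mx_coord => i' j'; rewrite mxE -seriesE; exact: cvg_u.
rewrite -/(u i j) seriesE.
apply: (cvg_comp _ (fun N : 'M[R]_d => N i j)) cvg_expmx _.
exact: coord_continuous.
Qed.

Let coef_gap_ge0 n k : 0 <= k`!%:R^-1 - n.+1%:R^-1 ^+ k *+ 'C(n.+1, k) :> R.
Proof.
rewrite subr_ge0 -mulr_natr exprVn mulrC ler_pdivrMr ?exprn_gt0//.
rewrite mulrC ler_pdivlMr ?ltr0n ?fact_gt0//.
by rewrite -natrM -natrX ler_nat bin_fact_le_expn.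
Qed.

(* The gap to the partial sums of the series is dominated by its scalar
   analogue at c, because the coefficients of (1 + x/N)^N never exceed those
   of exp. *)
Lemma cvg_expmx_compound i j :
  ((1 + n.+1%:R^-1 *: M) ^+ n.+1) i j @[n --> \oo] --> expmx M i j.
Proof.
pose u k := (k`!%:R^-1 *: M ^+ k) i j.
pose E n := ((1 + n.+1%:R^-1 *: M) ^+ n.+1) i j.
(* The binomial expansion of an [n.+1]-st power has [n.+2] terms, so the partial sum is cut at
   [n.+2] to match it term by term. *)
pose gap n := series (exp_coeff c) n.+2 - (1 + c / n.+1%:R) ^+ n.+1.
have cvg_u : series u n.+2 @[n --> \oo] --> expmx M i j.
  have := @expmx_coord i j; rewrite -/u -cvg_shiftS -[X in X -> _]cvg_shiftS.
  exact.
have cvg_gap : gap n @[n --> \oo] --> expR c - expR c.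
  apply: cvgB; last exact: cvg_expR_compound.
  have : series (exp_coeff c) n @[n --> \oo] --> expR c.
    exact: is_cvg_series_exp_coeff.
  by rewrite -cvg_shiftS -[X in X -> _]cvg_shiftS.
rewrite subrr in cvg_gap.
have gapP n : `|series u n.+2 - E n| <= gap n.
  have exprZ a k : (a *: M) ^+ k = a ^+ k *: M ^+ k.
    elim: k => [|k IHk]; first by rewrite !expr0 scale1r.
    by rewrite !exprS IHk -!mulmxE -scalemxAl -scalemxAr scalerA.
  have -> : series u n.+2 - E n = \sum_(k < n.+2)
      (k`!%:R^-1 - n.+1%:R^-1 ^+ k *+ 'C(n.+1, k)) * (M ^+ k) i j.
    rewrite /series/= big_mkord /E [1 + _]addrC exprD1n summxE -sumrB.
    apply: eq_bigr => k _; by rewrite /u exprZ scalerMnl !mxE mulrBl.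
  have -> : gap n = \sum_(k < n.+2)
      (k`!%:R^-1 - n.+1%:R^-1 ^+ k *+ 'C(n.+1, k)) * c ^+ k.
    rewrite /gap /series/= big_mkord [1 + _]addrC exprD1n -sumrB.
    apply: eq_bigr => k _; rewrite /exp_coeff/= mulrBl mulrC; congr (_ - _).
    by rewrite exprMn mulrC mulrnAl.
  rewrite (le_trans (ler_norm_sum _ _ _))//; apply: ler_sum => k _.
  by rewrite normrM ger0_norm ?coef_gap_ge0// ler_wpM2l.
have cvg_diff : series u n.+2 - E n @[n --> \oo] --> (0 : R).
  apply/norm_cvg0P; apply: (squeeze_cvgr _ (cvg_cst 0) cvg_gap).
  by apply: nearW => n; rewrite normr_ge0 gapP.
have -> : (fun n => E n) = (fun n => series u n.+2 - (series u n.+2 - E n)).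
  by apply/funext => n; rewrite opprB addrC subrK.
by rewrite -[expmx M i j]subr0; exact: cvgB.
Qed.

End matrix_exponential.

(** * Exponentials of matrices that are nonnegative off the diagonal *)

Section metzler.
Variables (R : realType) (d : nat) (M : 'M[R]_d).
Hypothesis M_metzler : forall i j, i != j -> 0 <= M i j.

(** Only diagonal entries could be negative, and they tend to 1; as there are finitely many entries,
    one threshold serves them all. *)
Let near_step_ge0 :
  \forall n \near \oo, forall i j, 0 <= (1 + n.+1%:R^-1 *: M) i j.
Proof.
apply: filter_forall => i; apply: filter_forall => j.
have [-> {i}|ij] := eqVneq i j.
  by apply: filterS (near_compound_ge0 (M j j)) => n; rewrite !mxE eqxx mulrC.
apply: nearW => n; rewrite !mxE (negbTE ij) add0r.
by rewrite mulr_ge0 ?M_metzler ?invr_ge0.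
Qed.

Lemma expmx_ge0 i j : 0 <= expmx M i j.
Proof.
apply: (ler_cvg_to (cvg_cst 0) (@cvg_expmx_compound _ _ M i j)).
apply: filterS near_step_ge0 => n; set P := (1 + _) => P_ge0.
elim: n.+1 i j => [|k IHk] i j.
  by rewrite expr0 mxE; case: (i == j).
by rewrite exprS -mulmxE mxE sumr_ge0// => l _; rewrite mulr_ge0.
Qed.

(** A nonnegative [P = 1 + M / N] preserves entrywise inequalities, so each application of [P] costs
    one factor [1 + b / N]; the [N] factors together are at most [expR b]. *)
Lemma expmx_mul_le (x : 'cV[R]_d) (b : R) :
  (forall i, 0 <= x i 0) -> (forall i, (M *m x) i 0 <= b * x i 0) ->
  forall i, (expmx M *m x) i 0 <= expR b * x i 0.
Proof.
move=> x_ge0 Mx_le i.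
have cvg_x : ((1 + n.+1%:R^-1 *: M) ^+ n.+1 *m x) i 0 @[n --> \oo]
    --> (expmx M *m x) i 0.
  under eq_cvg do rewrite mxE.
  rewrite mxE; apply: cvg_big => [|l _]; first exact: add_continuous.
  by apply: cvgM; [exact: cvg_expmx_compound | exact: cvg_cst].
apply: (ler_cvg_to cvg_x (cvg_cst _)).
near=> n.
(* [b] may be negative, so this factor is nonnegative only for large [n]. *)
have b_ge0 : 0 <= 1 + b / n.+1%:R by near: n; exact: near_compound_ge0.
have : forall i j, 0 <= (1 + n.+1%:R^-1 *: M) i j.
  by near: n; exact: near_step_ge0.
have : forall i, ((1 + n.+1%:R^-1 *: M) *m x) i 0 <= (1 + b / n.+1%:R) * x i 0.
  move=> l; rewrite mulmxDl mul1mx -scalemxAl !mxE mulrDl mul1r lerD2l.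
  rewrite mulrAC mulrC ler_wpM2r ?invr_ge0//.
  by have := Mx_le l; rewrite mxE.
set P := (1 + _) => Px_le P_ge0.
have Pk_le k l : (P ^+ k *m x) l 0 <= (1 + b / n.+1%:R) ^+ k * x l 0.
  elim: k l => [|k IHk] l; first by rewrite !expr0 mul1mx mul1r.
  rewrite exprS -mulmxE -mulmxA mxE.
  apply: (@le_trans _ _ (\sum_j P l j * ((1 + b / n.+1%:R) ^+ k * x j 0))).
    by apply: ler_sum => j _; rewrite ler_wpM2l.
  under eq_bigr do rewrite mulrCA.
  rewrite -mulr_sumr exprSr -mulrA ler_wpM2l ?exprn_ge0//.
  by have := Px_le l; rewrite mxE.
apply: le_trans (Pk_le _ _) _; rewrite ler_wpM2r//.
rewrite -[in leRHS](mulfVK (_ : n.+1%:R != 0 :> R) b) ?pnatr_eq0//.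
by rewrite expRM_natr lerXn2r ?nnegrE ?expR_ge0 ?expR_ge1Dx.
Unshelve. all: by end_near. Qed.

End metzler.

(** * Block-Toeplitz matrices and the row sums of their blocks *)

Section toeplitz.
Variables (R : realType) (m : nat).

(** [tagnat.Rank i s] is the flat index of position [s] in block [i]; the entrywise arguments below
    all go through it. *)
Lemma toeplitzE (N : nat) (B : 'I_N -> 'M[R]_m) (i j : 'I_N) (s t : 'I_m) :
  toeplitz B (@tagnat.Rank N (fun=> m) i s) (@tagnat.Rank N (fun=> m) j t) =
  if (i <= j)%N then B (ord_subn j i) s t else 0.
Proof.
have := mxblockK
  (fun i j : 'I_N => if (i <= j)%N then B (ord_subn j i) else 0) i j.
by move=> /matrixP/(_ s t); rewrite mxE => ->; case: ifP => // _; rewrite mxE.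
Qed.

Lemma toeplitz_mul_mxcol (N : nat) (B : 'I_N -> 'M[R]_m) (x : 'I_N -> 'cV[R]_m)
    (i : 'I_N) (s : 'I_m) :
  (toeplitz B *m \mxcol_j x j) (@tagnat.Rank N (fun=> m) i s) 0 =
  \sum_(j < N | (i <= j)%N) (B (ord_subn j i) *m x j) s 0.
Proof.
rewrite mul_mxblock_mxrow.
have /matrixP/(_ s 0) := mxcolK (fun i : 'I_N =>
  \sum_(j < N) ((if (i <= j)%N then B (ord_subn j i) else 0) *m x j)) i.
rewrite mxE => ->; rewrite summxE [RHS]big_mkcond/=; apply: eq_bigr => j _.
by case: ifP => // _; rewrite mul0mx mxE.
Qed.

Variables (n : nat) (n_gt0 : (0 < n)%N) (U : 'I_n -> 'M[R]_m).
Hypothesis U_subgen : subgenerator (toeplitz U).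

Let o := Ordinal n_gt0.
Let alpha := max_opp_diag (U o).

Lemma ord_subn0 (N : nat) (j : 'I_N) : ord_subn j 0 = j.
Proof. by apply: val_inj; rewrite /= subn0. Qed.

(** Every block occurs in the first block row, where the only diagonal entries of the large matrix
    are those of the block [U o]. *)
Lemma subgenerator_block_ge0 (i : 'I_n) (s t : 'I_m) :
  (i != o) || (s != t) -> 0 <= U i s t.
Proof.
move=> ist; have [offdiag _ _] := U_subgen.
have := offdiag (@tagnat.Rank n (fun=> m) o s) (@tagnat.Rank n (fun=> m) i t).
rewrite toeplitzE leq0n ord_subn0; apply.
by rewrite -val_eqE tagnat.eq_Rank negb_and eq_sym.
Qed.

(* The first block row alone carries the whole row-sum condition. *)
Lemma subgenerator_row_sum_le0 (s : 'I_m) : \sum_i (U i *m ones) s 0 <= 0.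
Proof.
have [_ _ /(_ (@tagnat.Rank n (fun=> m) o s))] := U_subgen.
apply: le_trans.
have -> : \sum_i (U i *m ones) s 0 =
    (toeplitz U *m \mxcol_j (ones : 'cV[R]_m)) (@tagnat.Rank n (fun=> m) o s) 0.
  by rewrite toeplitz_mul_mxcol; apply: eq_bigr => i _; rewrite ord_subn0.
by rewrite mxcol_const mxE; apply: ler_sum => j _; rewrite !mxE mulr1.
Qed.

Lemma max_opp_diag_ge (s : 'I_m) : - U o s s <= alpha.
Proof. exact: (le_bigmax _ (fun s => - U o s s)). Qed.

(** Row sums of the blocks, extended by 0 to all natural indices, so that sums over ranges can be
    split and shifted freely. *)
Let v (s : 'I_m) (i : nat) : R :=
  if insub i is Some i' then (U i' *m ones) s 0 else 0.

Let v_ge0 s i : (0 < i)%N -> 0 <= v s i.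
Proof.
move=> i_gt0; rewrite /v; case: insubP => // i' _ i'E.
rewrite mxE sumr_ge0// => t _; rewrite [ones _ _]mxE mulr1.
by rewrite subgenerator_block_ge0// -val_eqE /= i'E -lt0n i_gt0.
Qed.

Let v_ge s : - alpha <= v s 0%N.
Proof.
rewrite /v; case: insubP => [i _ i0|]; last by rewrite n_gt0.
have -> : i = o by apply: val_inj.
rewrite mxE (bigD1 s)//= [ones _ _]mxE mulr1.
apply: (@le_trans _ _ (U o s s)); first by rewrite lerNl max_opp_diag_ge.
rewrite lerDl sumr_ge0// => t ts; rewrite [ones _ _]mxE mulr1.
by rewrite subgenerator_block_ge0// eq_sym ts orbT.
Qed.

Variable K : nat.
Hypothesis n_le_K : (n <= K)%N.

Let v_sum_le0 s : \sum_(0 <= i < K) v s i <= 0.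
Proof.
rewrite (@big_cat_nat _ _ _ n)//= [X in _ + X]big1_seq ?addr0.
  rewrite big_mkord; under eq_bigr do rewrite /v valK.
  exact: subgenerator_row_sum_le0.
move=> i /=; rewrite mem_index_iota => /andP[n_le_i _]; rewrite /v.
by case: insubP => // ?; rewrite ltnNge n_le_i.
Qed.

Let tail_ge0 s a b : (0 < a)%N -> 0 <= \sum_(a <= i < b) v s i.
Proof.
move=> a_gt0; rewrite big_nat sumr_ge0// => i /andP[ai _].
by rewrite v_ge0// (leq_trans a_gt0).
Qed.

Let tail_le s k : (0 < k <= K)%N -> \sum_(1 <= i < k) v s i <= - v s 0%N.
Proof.
move=> /andP[k_gt0 kK]; apply: (@le_trans _ _ (\sum_(1 <= i < K) v s i)).
  by rewrite [leRHS](@big_cat_nat _ _ _ k)//= lerDl tail_ge0.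
have := v_sum_le0 s; rewrite big_ltn ?(leq_trans n_gt0)//.
by rewrite -lerBrDl sub0r.
Qed.

Variable sigma : R.
Hypothesis sigma_gt1 : 1 < sigma.

Let sigma_ge0 : 0 <= sigma.
Proof. exact: le_trans (ltW sigma_gt1). Qed.

Let beta := alpha * (sigma ^+ n.-1 - 1).

(** Write [w = sigma ^+ n.-1]. Replacing the weights of positive index by [w] bounds the sum by
    [v s 0 + w * tail]; since the tail is at most [- v s 0], this is at most [- v s 0 * (w - 1)],
    and [- v s 0 <= alpha]. The cut-off [k] is arbitrary because the lower block rows of the
    Toeplitz matrix see fewer blocks. *)
Let weighted_sum_le s k : (0 < k <= K)%N ->
  \sum_(0 <= i < k) sigma ^+ i * v s i <= beta.
Proof.
move=> /[dup] kK /andP[k_gt0 _]; rewrite big_ltn// expr0 mul1r.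
apply: (@le_trans _ _ (v s 0%N + sigma ^+ n.-1 * \sum_(1 <= i < k) v s i)).
  rewrite lerD2l mulr_sumr big_nat [leRHS]big_nat ler_sum// => i /andP[i_gt0 _].
  (* For [i >= n] the weight may exceed [sigma ^+ n.-1], but there [v s i] is 0 by padding. *)
  have [n_le_i|i_lt_n] := leqP n i.
    rewrite /v; case: insubP => [?|_]; first by rewrite ltnNge n_le_i.
    by rewrite !mulr0.
  by rewrite ler_wpM2r ?v_ge0// ler_eXn2l// -ltnS prednK.
have sigma_ge1 : 1 <= sigma ^+ n.-1 by rewrite exprn_ege1// ltW.
apply: (@le_trans _ _ (- v s 0%N * (sigma ^+ n.-1 - 1))).
  rewrite mulrBr mulr1 opprK addrC lerD2r mulrC ler_wpM2r ?tail_le//.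
  exact: le_trans sigma_ge1.
by rewrite ler_wpM2r ?subr_ge0// lerNl.
Qed.

(** * Action of the padded matrix on the weight vector *)

Let T := toeplitz (zero_pad K U).
Let x : 'cV[R]_(\sum_(i < K) m) := \mxcol_k (sigma ^+ k *: (ones : 'cV[R]_m)).

Let xE (k : 'I_K) s : x (@tagnat.Rank K (fun=> m) k s) 0 = sigma ^+ k.
Proof.
have /matrixP/(_ s 0) :=
  mxcolK (fun k : 'I_K => sigma ^+ k *: (ones : 'cV[R]_m)) k.
by rewrite mxE => ->; rewrite !mxE mulr1.
Qed.

Let x_ge0 k : 0 <= x k 0.
Proof. by rewrite -(tagnat.sig2K k) xE exprn_ge0// (le_trans ler01) ?ltW. Qed.

Let T_metzler k l : k != l -> 0 <= T k l.
Proof.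
rewrite -(tagnat.sig2K k) -(tagnat.sig2K l) -val_eqE /= tagnat.eq_Rank.
move: (tagnat.sig1 k) (tagnat.sig2 k) (tagnat.sig1 l) (tagnat.sig2 l).
move=> i s j t; rewrite toeplitzE negb_and /zero_pad => ijst.
case: ifP => // ij; case: insubP => [i' _ /= i'E|_]; last by rewrite mxE.
apply: subgenerator_block_ge0; case/orP: ijst => [ij'|->]; last by rewrite orbT.
by rewrite -val_eqE /= i'E subn_eq0 -ltnNge ltn_neqAle ij ij'.
Qed.

(** Shifting the column index by the block row [k] factors out [sigma ^+ k], the value of [x] there,
    and leaves the weighted sum over the first [K - k] blocks. *)
Let T_x_le k : (T *m x) k 0 <= beta * x k 0.
Proof.
rewrite -(tagnat.sig2K k); move: (tagnat.sig1 k) (tagnat.sig2 k) => {}k s.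
rewrite xE toeplitz_mul_mxcol.
have -> : \sum_(j < K | (k <= j)%N)
      (zero_pad K U (ord_subn j k) *m (sigma ^+ j *: ones)) s 0 =
    sigma ^+ k * \sum_(0 <= i < K - k) sigma ^+ i * v s i.
  transitivity (\sum_(j < K | (k <= j)%N) sigma ^+ j * v s (j - k)).
    apply: eq_bigr => j _; rewrite -scalemxAr mxE /zero_pad /v /=.
    by case: insub => // ; rewrite mul0mx mxE.
  rewrite -(big_mkord (fun j => (k <= j)%N)
    (fun j => sigma ^+ j * v s (j - k)%N)).
  rewrite -(@big_nat_widenl _ _ _ k 0 K xpredT)// -{1}[val k]add0n.
  rewrite big_addn mulr_sumr.
  by apply: eq_bigr => i _; rewrite addnK exprD mulrCA mulrA.
rewrite [leRHS]mulrC ler_wpM2l ?exprn_ge0//.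
by rewrite weighted_sum_le// subn_gt0 ltn_ord leq_subr.
Qed.

Lemma toeplitz_exp_row_sum_le (A : 'I_K -> 'M[R]_m) (i : 'I_K) (s : 'I_m) :
  toeplitz A = expmx T -> sigma ^+ i * (A i *m ones) s 0 <= expR beta.
Proof.
move=> A_exp.
have K_gt0 : (0 < K)%N by exact: leq_trans n_le_K.
pose oK := Ordinal K_gt0.
(* All blocks [A j] appear in the first block row of the exponential, which is entrywise
   nonnegative. *)
have A_ge0 j t u : 0 <= A j t u.
  have := expmx_ge0 T_metzler (@tagnat.Rank K (fun=> m) oK t)
    (@tagnat.Rank K (fun=> m) j u).
  by rewrite -A_exp toeplitzE leq0n ord_subn0.
have := expmx_mul_le T_metzler x_ge0 T_x_le (@tagnat.Rank K (fun=> m) oK s).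
rewrite xE expr0 mulr1 -A_exp toeplitz_mul_mxcol; apply: le_trans.
have termE j : (A (ord_subn j oK) *m (sigma ^+ j *: ones)) s 0 =
    sigma ^+ j * (A j *m ones) s 0.
  by rewrite ord_subn0 -scalemxAr mxE.
(* All terms being nonnegative, the [i]-th one alone is at most the whole sum. *)
rewrite (eq_bigr _ (fun j _ => termE j)) (bigD1 i)//= lerDl sumr_ge0// => j _.
rewrite mulr_ge0 ?exprn_ge0//.
by rewrite mxE sumr_ge0// => t _; rewrite mulr_ge0// mxE.
Qed.

End toeplitz.

Theorem theorem9 (R : realType) (m n : nat) (n_gt0 : (0 < n)%N)
    (U : 'I_n -> 'M[R]_m) (U_subgen : subgenerator (toeplitz U))
    (K : nat) (n_le_K : (n <= K)%N)
    (A : 'I_K -> 'M[R]_m)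
    (A_exp : toeplitz A = expmx (toeplitz (zero_pad K U)))
    (sigma : R) (sigma_gt1 : 1 < sigma) :
  let alpha := max_opp_diag (U (Ordinal n_gt0)) in
  forall (i : 'I_K) (j : 'I_m),
    (A i *m ones) j ord0
      <= ((expR (alpha * (sigma ^+ n.-1 - 1)) * sigma ^- i) *: ones) j ord0.
Proof.
move=> alpha i j; rewrite [leRHS]mxE [ones _ _]mxE mulr1.
rewrite ler_pdivlMr ?exprn_gt0 ?(lt_trans ltr01)// mulrC.
exact: toeplitz_exp_row_sum_le.
Qed.
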